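(* Let $q\ge 3$ be a power of a prime $p$. The DGZ curve is non-classical and $\mathbb{F}_q$-Frobenius non-classical.
   Context: Put $D_1(x,y,z)=\begin{vmatrix} x & x^q & x^{q^3}\\ y & y^q & y^{q^3}\\ z & z^q & z^{q^3}\end{vmatrix}$, $D_2(x,y,z)=\begin{vmatrix} x & x^q & x^{q^2}\\ y & y^q & y^{q^2}\\ z & z^q & z^{q^2}\end{vmatrix}$ and $F=D_1/D_2$, an absolutely irreducible homogeneous polynomial of degree $q^3-q^2$ over $\mathbb{F}_q$. The DGZ curve is the plane curve over $\overline{\mathbb{F}}_q$ with equation $F(x,y,z)=0$. An absolutely irreducible plane curve is non-classical if each of its nonsingular points is a flex, i.e. the tangent line at each nonsingular point $P$ meets the curve at $P$ with intersection multiplicity at least $3$. A plane curve defined over $\mathbb{F}_q$ is $\mathbb{F}_q$-Frobenius non-classical if the tangent at any nonsingular point $P=(a:b:c)$ of the curve (over $\overline{\mathbb{F}}_q$) contains the point $P^q=(a^q:b^q:c^q)$. *)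

(* Defs.v *)
From mathcomp Require Import all_boot all_order all_fingroup all_algebra all_solvable all_field.
From mathcomp Require Import ring.
From mathcomp.multinomials Require Import mpoly.

Set Implicit Arguments.
Unset Strict Implicit.
Unset Printing Implicit Defensive.

Import GRing.Theory.
Local Open Scope ring_scope.

Section DGZPolynomial.
Variable Fq : finFieldType.
Local Notation q := #|Fq|.

Definition frobenius_det (e : 3.-tuple nat) : {mpoly Fq[3]} :=
  \det (\matrix_(i < 3, j < 3) 'X_i ^+ (q ^ tnth e j)).

Definition dgz_D1 : {mpoly Fq[3]} := frobenius_det [tuple 0; 1; 3]%N.
Definition dgz_D2 : {mpoly Fq[3]} := frobenius_det [tuple 0; 1; 2]%N.

Lemma det3E (R : comNzRingType) (f : 'I_3 -> 'I_3 -> R) :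
  let a i j := f (inord i) (inord j) in
  \det (\matrix_(i, j) f i j) =
    a 0%N 0%N * (a 1%N 1%N * a 2%N 2%N - a 1%N 2%N * a 2%N 1%N)
  - a 0%N 1%N * (a 1%N 0%N * a 2%N 2%N - a 1%N 2%N * a 2%N 0%N)
  + a 0%N 2%N * (a 1%N 0%N * a 2%N 1%N - a 1%N 1%N * a 2%N 0%N).
Proof.
move=> a.
have aE i j : f i j = a i j by rewrite /a !inord_val.
do !rewrite (expand_det_row _ ord0) !big_ord_recl big_ord0 /cofactor.
rewrite !det_mx00 !mxE !aE /= /bump /=.
rewrite -!plusE /=; ring.
Qed.

Lemma dgz_D2_neq0 : dgz_D2 != 0.
Proof.
pose m (s : 'S_3) : 'X_{1..3} := [multinom (q ^ s i)%N | i < 3].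
have q1 : (1 < q)%N by apply: finNzRing_gt1.
have mI : injective m.
  move=> s t /mnmP mst; apply/permP=> i; apply/val_inj => /=.
  by have /eqP := mst i; rewrite !mnmE eqn_exp2l // => /eqP.
have coefM (s t : 'S_3) :
    (\prod_i (\matrix_(i < 3, j < 3) ('X_i ^+ (q ^ tnth [tuple 0; 1; 2]%N j)
        : {mpoly Fq[3]})) i (s i))@_(m t) = (s == t)%:R.
  rewrite (eq_bigr (fun i => 'X_i ^+ m s i)) => [|i _].
    by rewrite -mpolyXE_id mcoeffX (inj_eq mI).
  rewrite mxE mnmE (tnth_nth 0%N) /=; congr (_ ^+ (_ ^ _)).
  by case: (s i) => [[|[|[|]]]].
apply/eqP=> /(congr1 (mcoeff (m 1%g))) /eqP.
rewrite mcoeff0 /dgz_D2 /frobenius_det /determinant (raddf_sum (mcoeff (m 1%g))) /=.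
rewrite (bigD1 (1%g : 'S_3)) //=.
rewrite [X in _ + X]big1 ?addr0 => [|s s1]; last first.
  by case: (odd_perm s); rewrite ?expr1 ?expr0 ?mulN1r ?mul1r
    ?mcoeffN coefM (negPf s1) ?oppr0.
by rewrite odd_perm1 expr0 mul1r coefM eqxx oner_eq0.
Qed.

(* Each 'X_i is a root of the monic q-polynomial whose roots are the
   Fq-linear combinations of 'X_0, 'X_1, 'X_2; the quotient D1 / D2 is minus
   its coefficient at T^(q^2). *)
Lemma dgz_subproof : exists F : {mpoly Fq[3]}, F * dgz_D2 == dgz_D1.
Proof.
have [p p_pr pFq] := finPcharP Fq.
have pX : p \in [pchar {mpoly Fq[3]}].
  by apply: (rmorph_pchar (@mpolyC 3 Fq)).
have qX : [pchar {mpoly Fq[3]}].-nat q.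
  rewrite (eq_pnat _ (pcharf_eq pX)).
  have /p_natP [k ->] : p.-nat q.
    have := fin_ring_pchar_abelem pFq.
    by move=> /abelem_pgroup; rewrite /pgroup cardsT.
  by rewrite pnatX pnat_id.
have q0 : (0 < q)%N by rewrite ltnW // finNzRing_gt1.
have qB (a b : {mpoly Fq[3]}) : (a - b) ^+ q = a ^+ q - b ^+ q.
  by rewrite exprDn_pchar // exprNn_pchar.
pose x : {mpoly Fq[3]} := 'X_(inord 0).
pose y : {mpoly Fq[3]} := 'X_(inord 1).
pose z : {mpoly Fq[3]} := 'X_(inord 2).
have exq (a : {mpoly Fq[3]}) : a ^+ q = a ^+ q.-1 * a by rewrite -exprSr prednK.
pose al := x ^+ q.-1.
pose P1 T := T ^+ q - al * T.
pose be := P1 y ^+ q.-1.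
pose P2 T := P1 T ^+ q - be * P1 T.
pose ga := P2 z ^+ q.-1.
pose P3 T := P2 T ^+ q - ga * P2 T.
have P1x : P1 x = 0 by rewrite /P1 exq subrr.
have P20 T : P1 T = 0 -> P2 T = 0 by move=> h; rewrite /P2 h expr0n mulr0 -leqn0 leqNgt q0 subrr.
have P30 T : P2 T = 0 -> P3 T = 0 by move=> h; rewrite /P3 h expr0n mulr0 -leqn0 leqNgt q0 subrr.
have P3x : P3 x = 0 by apply/P30/P20.
have P3y : P3 y = 0 by apply/P30; rewrite /P2 exq subrr.
have P3z : P3 z = 0 by rewrite /P3 exq subrr.
pose F := (al ^+ q + be) ^+ q + ga.
pose B := - ((be * al) ^+ q + ga * (al ^+ q + be)).
pose C := ga * (be * al).
have P2E T : P2 T = T ^+ (q ^ 2) - (al ^+ q + be) * T ^+ q + be * al * T.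
  by rewrite /P2 /P1 qB exprMn -!exprM mulnn; ring.
have P3E T : P3 T = T ^+ (q ^ 3) - F * T ^+ (q ^ 2) - B * T ^+ q - C * T.
  rewrite /P3 P2E /F /B /C exprDn_pchar // qB !exprMn -!exprM -expnSr mulnn.
  by ring.
have E T : P3 T = 0 ->
    T ^+ (q ^ 3) = F * T ^+ (q ^ 2) + B * T ^+ q + C * T.
  by rewrite P3E => h; apply/eqP; rewrite -subr_eq0 -h; apply/eqP; ring.
exists F; apply/eqP; rewrite /dgz_D1 /dgz_D2 /frobenius_det !det3E /=.
rewrite !(tnth_nth 0%N) !inordK //= -/x -/y -/z !expn0 !expn1 !expr1.
by rewrite (E _ P3x) (E _ P3y) (E _ P3z); ring.
Qed.

Definition dgz : {mpoly Fq[3]} := xchoose dgz_subproof.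

Lemma dgzP (F : {mpoly Fq[3]}) : F * dgz_D2 = dgz_D1 <-> F = dgz.
Proof.
have h : dgz * dgz_D2 = dgz_D1 by apply/eqP/(xchooseP dgz_subproof).
by split=> [|->//]; rewrite -h => /(mulIf dgz_D2_neq0).
Qed.

End DGZPolynomial.

(* A point of the projective plane over K is given by a nonzero row vector of
   homogeneous coordinates, a line by the row vector of its coefficients, and a
   plane curve by a homogeneous polynomial G. *)
Section PlaneCurves.
Variable K : fieldType.
Implicit Types (G : {mpoly K[3]}) (P Q l : 'rV[K]_3).

Definition on_line l Q : bool := \sum_i l 0 i * Q 0 i == 0.

Definition gradient G P : 'rV[K]_3 := \row_i (mderiv i G).@[P 0].

Definition nonsingular_point G P : bool :=
  [&& P != 0, G.@[P 0] == 0 & gradient G P != 0].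

(* At a nonsingular point, the gradient is the coefficient vector of the
   tangent line. *)
Definition tangent_line G P : 'rV[K]_3 := gradient G P.

(* G (P + t Q), as a polynomial in t *)
Definition line_restriction G P Q : {poly K} :=
  mmap (@polyC K) (fun i => (P 0 i)%:P + Q 0 i *: 'X) G.

(* The line l meets the curve G = 0 at its point P with multiplicity at least
   m: for P + t Q a parametrization of l, t = 0 is a root of G (P + t Q) of
   multiplicity at least m.  The multiplicity is infinite (every m is allowed)
   when l is a component of the curve. *)
Definition intersection_mult_ge G l P (m : nat) : Prop :=
  forall Q, on_line l Q -> ~~ (Q <= P)%MS -> 'X^m %| line_restriction G P Q.

Definition flex G P : Prop := intersection_mult_ge G (tangent_line G P) P 3.

(* The notion is meant for absolutely irreducible curves; nothing in it needs
   irreducibility, which is therefore not part of the predicate. *)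
Definition non_classical G : Prop :=
  forall P, nonsingular_point G P -> flex G P.

End PlaneCurves.

(* The curve has coefficients in Fq; its points have coordinates in K. *)
Definition frobenius_non_classical (Fq : finFieldType) (K : fieldType)
    (iota : {rmorphism Fq -> K}) (F : {mpoly Fq[3]}) : Prop :=
  let G := map_mpoly iota F in
  forall P : 'rV[K]_3, nonsingular_point G P ->
    on_line (tangent_line G P) (map_mx (fun a => a ^+ #|Fq|) P).

(* Main.v *)
Require Import Defs.
From mathcomp Require Import all_boot all_order all_fingroup all_algebra.
From mathcomp Require Import all_solvable all_field.
From mathcomp Require Import ring.
From mathcomp.multinomials Require Import mpoly.

Set Implicit Arguments.
Unset Strict Implicit.
Unset Printing Implicit Defensive.

Import GRing.Theory.
Local Open Scope ring_scope.

(* Write P^(k) for the image of P under the q^k-power Frobenius, so that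
   D1 = det (P, P^(1), P^(3)) and D2 = det (P, P^(1), P^(2)).  Differentiating
   F D2 = D1 gives grad F = - D2^(q-2) (P x P^(1)).  As q >= 3, D2 does not
   vanish at a nonsingular point P, whose tangent is therefore the line through
   P and P^(1).  For Q on that line, and as q >= 3,
     D1 (P + t Q) = D1 (P) + t det (Q, P^(1), P^(3)) mod t^3,
   where D1 (P) = 0 puts P^(3) on the tangent as well, so that both terms vanish.
   Since D2 (P + t Q) is a unit mod t^3, t^3 divides F (P + t Q). *)

(** * Determinants of order 3 through cross and triple products *)

Section CrossProduct.
Variable R : comNzRingType.
Implicit Types u v w : 'I_3 -> R.

(* 'I_3 is used as Z/3: i + 1 and i - 1 are modulo 3. *)
Definition cross u v (i : 'I_3) : R :=
  u (i + 1) * v (i - 1) - u (i - 1) * v (i + 1).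

Definition triple u v w : R := \sum_i cross u v i * w i.

Lemma ord3_ind (P : 'I_3 -> Prop) : P 0 -> P 1 -> P (- 1) -> forall i, P i.
Proof.
move=> P0 P1 P2 [[|[|[|//]]] lti]; [move: P0|move: P1|move: P2];
  by congr P; apply/val_inj.
Qed.

Lemma sum3E (F : 'I_3 -> R) : \sum_i F i = F 0 + F 1 + F (- 1).
Proof.
rewrite !big_ord_recl big_ord0 addr0 addrA.
by congr (F _ + F _ + F _); apply/val_inj.
Qed.

Lemma cross3E u v :
  ((cross u v 0 = u 1 * v (- 1) - u (- 1) * v 1) *
  (cross u v 1 = u (- 1) * v 0 - u 0 * v (- 1)) *
  (cross u v (- 1) = u 0 * v 1 - u 1 * v 0))%type.
Proof.
have e1 : 1 + 1 = - 1 :> 'I_3 by apply/val_inj.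
have e2 : - 1 - 1 = 1 :> 'I_3 by apply/val_inj.
by rewrite /cross !add0r !subrr !addNr e1 e2.
Qed.

Definition tripleE := (sum3E, cross3E).

Lemma det_triple u v w :
  \det (\matrix_(i < 3, j < 3) [:: u i; v i; w i]`_j) = triple u v w.
Proof.
rewrite det3E /triple !tripleE !inordK //=.
have -> : inord 0 = 0 :> 'I_3 by apply/val_inj; rewrite /= inordK.
have -> : inord 1 = 1 :> 'I_3 by apply/val_inj; rewrite /= inordK.
have -> : inord 2 = - 1 :> 'I_3 by apply/val_inj; rewrite /= inordK.
by ring.
Qed.

Lemma triple_vvr u v : triple u v v = 0.
Proof. by rewrite /triple !tripleE; ring. Qed.

(** With [v] fixed, [triple x v y] is a 2 by 2 bracket of [x] and [y] modulo [v]; this is the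
    three-term Pluecker relation for [u], [a], [b], [t]. *)
Lemma triple_pluecker u v a b t :
  triple a v b * triple u v t
  = triple u v b * triple a v t - triple u v a * triple b v t.
Proof. by rewrite /triple !tripleE; ring. Qed.

(** As [cross v w i] is the triple product of [v], [w] and the i-th unit vector, this is again the
    three-term relation modulo [v], for [u], [w], [t] and that vector. *)
Lemma cross_mul_triple u v w t (i : 'I_3) :
  cross v w i * triple u v t - triple u v w * cross v t i
    = - (triple v t w * cross u v i).
Proof. by elim/ord3_ind: i; rewrite /triple !tripleE; ring. Qed.

(** Linearity in the first vector isolates [s]; every term with [v'] or [w'] carries a factor [t].
    On a line, [s] will be the parameter and [t] its cube. *)
Lemma triple_perturb u v w u' v' w' (s t : R) : exists r,
  triple (fun i => u i + s * u' i) (fun i => v i + t * v' i)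
    (fun i => w i + t * w' i)
  = triple u v w + s * triple u' v w + t * r.
Proof.
pose a i := u i + s * u' i.
exists (triple a v' (fun i => w i + t * w' i) + triple a v w').
by rewrite /a /triple !tripleE; ring.
Qed.

End CrossProduct.

Lemma rmorph_cross (R S : comNzRingType) (f : {rmorphism R -> S})
    (u v : 'I_3 -> R) i : f (cross u v i) = cross (f \o u) (f \o v) i.
Proof. by rewrite /cross rmorphB !rmorphM. Qed.

Lemma rmorph_triple (R S : comNzRingType) (f : {rmorphism R -> S})
    (u v w : 'I_3 -> R) : f (triple u v w) = triple (f \o u) (f \o v) (f \o w).
Proof.
rewrite /triple rmorph_sum; apply: eq_bigr => i _.
by rewrite rmorphM rmorph_cross.
Qed.

Lemma eq_triple (R : comNzRingType) (u v w u' v' w' : 'I_3 -> R) :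
  u =1 u' -> v =1 v' -> w =1 w' -> triple u v w = triple u' v' w'.
Proof.
by move=> eu ev ew; apply: eq_bigr => i _; rewrite /cross !eu !ev ew.
Qed.

(** The derivation treats [v] and [w] as constants, so only the cofactor of the i-th entry of [u]
    survives. *)
Lemma mderiv_triple (R : comNzRingType) (u v w : 'I_3 -> {mpoly R[3]}) i :
  (forall j, mderiv i (u j) = (i == j)%:R) -> (forall j, mderiv i (v j) = 0) ->
  (forall j, mderiv i (w j) = 0) -> mderiv i (triple u v w) = cross v w i.
Proof.
move=> du dv dw; rewrite /triple !tripleE.
rewrite !mderivD !mderivM !mderivB !mderivM !du !dv !dw.
by elim/ord3_ind: i {du dv dw}; rewrite !tripleE /=; ring.
Qed.

Lemma mderiv_map_mpoly (n : nat) (R S : nzRingType) (f : {rmorphism R -> S})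
    (i : 'I_n) (G : {mpoly R[n]}) :
  mderiv i (map_mpoly f G) = map_mpoly f (mderiv i G).
Proof.
by apply/mpolyP => m; rewrite !(mcoeff_mderiv, mcoeff_map_mpoly) raddfMn.
Qed.

Lemma mderiv_Xn_pchar (n : nat) (R : nzRingType) (i j : 'I_n) (k : nat) :
  k%:R = 0 :> R -> mderiv i ('X_j ^+ k : {mpoly R[n]}) = 0.
Proof.
move=> k0; rewrite mpolyXn mderivX mulmnE mulnC natrM k0 mul0r.
by rewrite scale0r.
Qed.

(** * The gradient of the DGZ polynomial *)

Section DGZGradient.
Variable Fq : finFieldType.
Local Notation q := #|Fq|.
Local Notation D2 := (dgz_D2 Fq).
Local Notation Xq k := (fun i : 'I_3 => 'X_i ^+ (q ^ k) : {mpoly Fq[3]}).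

Lemma frobenius_detE (a b c : nat) :
  frobenius_det Fq [tuple a; b; c] = triple (Xq a) (Xq b) (Xq c).
Proof.
rewrite -det_triple /frobenius_det; congr (\det _).
apply/matrixP=> i j; rewrite !mxE (tnth_nth 0%N) /=.
by case: j => [[|[|[|]]]].
Qed.

Lemma dgz_mul_D2 : dgz Fq * D2 = dgz_D1 Fq.
Proof. exact/dgzP. Qed.

(** Lagrange's theorem in the additive group of [Fq]. *)
Lemma natr_card_finField : q%:R = 0 :> Fq.
Proof. by rewrite -FinRing.zmodXgE -cardsT expg_cardG ?inE. Qed.

(** The additive group of [Fq] is an elementary abelian p-group. This is the form in which
    additivity of the q-th power map is invoked. *)
Lemma card_finField_pchar (R : nzRingType) (f : {rmorphism Fq -> R}) :
  [pchar R].-nat q.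
Proof.
have [p p_pr pFq] := finPcharP Fq.
rewrite (eq_pnat _ (pcharf_eq (rmorph_pchar f pFq))) -cardsT.
exact: abelem_pgroup (fin_ring_pchar_abelem pFq).
Qed.

Lemma triple_Xq a b c :
  triple (Xq a) (Xq b) (Xq c) ^+ q = triple (Xq a.+1) (Xq b.+1) (Xq c.+1).
Proof.
have qX := card_finField_pchar (@mpolyC 3 Fq).
rewrite /triple !tripleE !exprDn_pchar // !exprMn !exprDn_pchar //.
by rewrite !exprNn_pchar // !exprMn -!exprM -!expnSr.
Qed.

(* By a Pluecker relation, F_i D2^2 = (D1)_i D2 - D1 (D2)_i is a multiple of
   det (X^(1), X^(2), X^(3)) = D2^q. *)
Lemma mderiv_dgz i : (3 <= q)%N ->
  mderiv i (dgz Fq) = - (D2 ^+ (q - 2) * cross (Xq 0) (Xq 1) i).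
Proof.
move=> q3; have q0 : (0 < q)%N by apply: leq_trans q3.
have D2E : D2 = triple (Xq 0) (Xq 1) (Xq 2) by apply: frobenius_detE.
have D1E : dgz_D1 Fq = triple (Xq 0) (Xq 1) (Xq 3) by apply: frobenius_detE.
have d0 j : mderiv i (Xq 0 j) = (i == j)%:R.
  rewrite expn0 expr1 mderivX mnm1E eq_sym; case: eqP => [->|_].
    have -> : (U_(j) - U_(j) = 0)%MM.
      by apply/mnmP=> l; rewrite mnmBE subnn mnm0E.
    by rewrite scale1r mpolyX0.
  by rewrite scale0r.
have dk k j : mderiv i (Xq k.+1 j) = 0.
  by rewrite mderiv_Xn_pchar // expnS natrM natr_card_finField mul0r.
have dD2 : mderiv i D2 = cross (Xq 1) (Xq 2) i by rewrite D2E mderiv_triple.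
have dD1 : mderiv i (dgz_D1 Fq) = cross (Xq 1) (Xq 3) i.
  by rewrite D1E mderiv_triple.
have := congr1 (mderiv i) dgz_mul_D2; rewrite mderivM dD2 dD1 => dF.
apply: (mulIf (expf_neq0 2 (dgz_D2_neq0 Fq))).
have -> : mderiv i (dgz Fq) * D2 ^+ 2
    = - (dgz_D1 Fq * cross (Xq 1) (Xq 2) i - cross (Xq 1) (Xq 3) i * D2).
  by rewrite -dF -dgz_mul_D2; ring.
rewrite mulNr mulrAC -exprD subnK ?(ltnW q3) //.
(* Only the D2 under the exponent q is expanded first: its q-th power is det (X^(1), X^(2), X^(3)),
   and what remains is an instance of the identity in [cross_mul_triple]. *)
rewrite {2}D2E triple_Xq D1E D2E.
rewrite /triple; elim/ord3_ind: i {d0 dk dD2 dD1 dF}; rewrite !tripleE /=.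
all: by ring.
Qed.

End DGZGradient.

(** * Values at a point, restrictions to a line, and the tangent *)

Section DGZPoint.
Variables (Fq : finFieldType) (K : fieldType) (iota : {rmorphism Fq -> K}).
Local Notation q := #|Fq|.
Local Notation Xq k := (fun i : 'I_3 => 'X_i ^+ (q ^ k) : {mpoly Fq[3]}).
Local Notation pt P k := (fun i : 'I_3 => P 0 i ^+ (q ^ k)).
Implicit Types P Q : 'rV[K]_3.

(** Evaluation and restriction are packaged as ring morphisms so that they pass through [triple] by
    [rmorph_triple]. *)
Definition eval_at P : {rmorphism {mpoly Fq[3]} -> K} :=
  meval (P 0) \o map_mpoly iota.

Definition restrict_to_line P Q : {rmorphism {mpoly Fq[3]} -> {poly K}} :=
  mmap (@polyC K) (fun i => (P 0 i)%:P + Q 0 i *: 'X) \o map_mpoly iota.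

Lemma eval_at_Xq P k i : eval_at P (Xq k i) = pt P k i.
Proof. by rewrite rmorphXn /= map_mpolyX mevalXU. Qed.

Lemma eval_at_frobenius_det P a b c :
  eval_at P (frobenius_det Fq [tuple a; b; c])
  = triple (pt P a) (pt P b) (pt P c).
Proof.
rewrite frobenius_detE rmorph_triple.
by apply: eq_triple => i; apply: eval_at_Xq.
Qed.

(** Additivity of the Frobenius leaves no power of ['X] strictly between 0 and q^k; this is the
    source of the high contact. *)
Lemma restrict_to_line_Xq P Q k i :
  restrict_to_line P Q (Xq k i)
  = (pt P k i)%:P + 'X^(q ^ k) * (pt Q k i)%:P.
Proof.
have qX : [pchar {poly K}].-nat (q ^ k)%N.
  by rewrite pnatX (card_finField_pchar (@polyC K \o iota)).
rewrite rmorphXn /= map_mpolyX mmapX mmap1U exprDn_pchar //.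
by rewrite exprZn -mul_polyC mulrC !polyC_exp.
Qed.

Lemma restrict_to_line_frobenius_det P Q a b c :
  restrict_to_line P Q (frobenius_det Fq [tuple a; b; c])
  = triple (fun i => (pt P a i)%:P + 'X^(q ^ a) * (pt Q a i)%:P)
      (fun i => (pt P b i)%:P + 'X^(q ^ b) * (pt Q b i)%:P)
      (fun i => (pt P c i)%:P + 'X^(q ^ c) * (pt Q c i)%:P).
Proof.
rewrite frobenius_detE rmorph_triple.
by apply: eq_triple => i; apply: restrict_to_line_Xq.
Qed.

Lemma restrict_to_line_at0 P Q a b c :
  (restrict_to_line P Q (frobenius_det Fq [tuple a; b; c])).[0]
  = eval_at P (frobenius_det Fq [tuple a; b; c]).
Proof.
have q0 k : 0 ^+ (q ^ k) = 0 :> K.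
  by rewrite expr0n expn_eq0 eqn0Ngt (ltnW (finNzRing_gt1 _)).
rewrite restrict_to_line_frobenius_det eval_at_frobenius_det.
rewrite -[LHS]/(horner_eval 0 _) rmorph_triple.
by apply: eq_triple => i; rewrite /= /horner_eval !hornerE q0 mul0r addr0.
Qed.

Lemma gradient_dgz P i : (3 <= q)%N ->
  gradient (map_mpoly iota (dgz Fq)) P 0 i
  = - (eval_at P (dgz_D2 Fq) ^+ (q - 2) * cross (pt P 0) (pt P 1) i).
Proof.
move=> q3; rewrite mxE mderiv_map_mpoly mderiv_dgz //.
rewrite -[LHS]/(eval_at P _) rmorphN rmorphM rmorphXn rmorph_cross.
rewrite /cross; congr (- (_ * (_ * _ - _ * _))); apply: eval_at_Xq.
Qed.

Lemma on_tangent_dgz P Q : (3 <= q)%N ->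
  on_line (gradient (map_mpoly iota (dgz Fq)) P) Q
  = (eval_at P (dgz_D2 Fq) == 0)
    || (triple (pt P 0) (pt P 1) (fun i => Q 0 i) == 0).
Proof.
move=> q3; rewrite /on_line.
under eq_bigr do rewrite gradient_dgz // mulNr -mulrA.
(* A power of D2 (P) vanishes with D2 (P) only for a positive exponent; q - 2 is one since q >=
   3. *)
rewrite sumrN oppr_eq0 -mulr_sumr mulf_eq0 expf_eq0.
by rewrite subn_gt0 q3.
Qed.

Lemma dgz_D2_nonsingular P : (3 <= q)%N ->
  nonsingular_point (map_mpoly iota (dgz Fq)) P -> eval_at P (dgz_D2 Fq) != 0.
Proof.
move=> q3 /and3P [_ _]; apply: contraNneq => D20.
apply/eqP/rowP=> i; rewrite gradient_dgz // D20 expr0n subn_eq0 leqNgt q3.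
by rewrite mul0r oppr0 mxE.
Qed.

Lemma dgz_flex P : (3 <= q)%N ->
  nonsingular_point (map_mpoly iota (dgz Fq)) P ->
  flex (map_mpoly iota (dgz Fq)) P.
Proof.
move=> q3 nsP Q; have D2P := dgz_D2_nonsingular q3 nsP.
rewrite /tangent_line on_tangent_dgz // (negPf D2P) /= => /eqP tQ _.
have D1P : triple (pt P 0) (pt P 1) (pt P 3) = 0.
  rewrite -eval_at_frobenius_det -[X in eval_at P X]dgz_mul_D2 rmorphM /=.
  by case/and3P: nsP => _ /eqP -> _; rewrite mul0r.
(* The value at 0 is D2 (P), which is nonzero; Gauss's lemma then reduces the goal to divisibility
   of D1 (P + t Q). *)
have coD2 : coprimep ('X^3) (restrict_to_line P Q (dgz_D2 Fq)).
  rewrite coprimep_expl // coprimep_sym coprimepX /root.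
  by rewrite restrict_to_line_at0.
have -> : line_restriction (map_mpoly iota (dgz Fq)) P Q
    = restrict_to_line P Q (dgz Fq) by [].
rewrite -(Gauss_dvdpl _ coD2) -rmorphM dgz_mul_D2.
have X3 k : 'X^(q ^ k.+1) = 'X^3 * 'X^(q ^ k.+1 - 3) :> {poly K}.
  rewrite -exprD subnKC // (leq_trans q3) // -{1}[q]expn1 leq_pexp2l //.
  exact: leq_trans q3.
pose C k i := (pt P k i)%:P.
pose V k i := 'X^(q ^ k - 3) * (pt Q k i)%:P.
have -> : restrict_to_line P Q (dgz_D1 Fq)
    = triple (fun i => C 0%N i + 'X * (Q 0 i)%:P)
        (fun i => C 1%N i + 'X^3 * V 1%N i) (fun i => C 3%N i + 'X^3 * V 3%N i).
  rewrite restrict_to_line_frobenius_det.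
  by apply: eq_triple => i; rewrite /C /V ?mulrA -?X3 // expn0 !expr1.
have tC (u v w : 'I_3 -> K) :
    triple (polyC \o u) (polyC \o v) (polyC \o w) = (triple u v w)%:P.
  by rewrite rmorph_triple.
have [r ->] := triple_perturb (C 0%N) (C 1%N) (C 3%N) (fun i => (Q 0 i)%:P)
  (V 1%N) (V 3%N) 'X ('X^3).
(* Pluecker relation modulo P^(1) for P, Q, P^(3), P^(2): multiplied by D2 (P), the determinant is a
   sum of two terms, killed by D1 (P) = 0 and by Q being on the tangent. *)
have QP : triple (fun i => Q 0 i) (pt P 1) (pt P 3) = 0.
  move: D2P; rewrite eval_at_frobenius_det => D2P; apply: (mulIf D2P).
  by rewrite triple_pluecker D1P tQ !mul0r subrr.
by rewrite !tC D1P QP mulr0 !add0r dvdp_mulr.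
Qed.

(** The incidence reduces to det (P, P^(1), P^(1)), which has a repeated vector. *)
Lemma dgz_frobenius P : (3 <= q)%N ->
  on_line (tangent_line (map_mpoly iota (dgz Fq)) P)
    (map_mx (fun a => a ^+ q) P).
Proof.
move=> q3; rewrite /tangent_line on_tangent_dgz //; apply/orP; right.
rewrite -[X in _ == X](triple_vvr (pt P 0) (pt P 1)); apply/eqP.
by apply: eq_triple => i //; rewrite mxE expn1.
Qed.

End DGZPoint.

Theorem proposition8p1 (p n q : nat) (Fq : finFieldType) (K : closedFieldType)
    (iota : {rmorphism Fq -> K}) :
  prime p -> q = (p ^ n)%N -> (3 <= q)%N -> #|Fq| = q ->
  (* K is an algebraic closure of Fq *)
  (forall a : K, algebraicOver iota a) ->
  non_classical (map_mpoly iota (dgz Fq)) /\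
  frobenius_non_classical iota (dgz Fq).
Proof.
move=> _ _ q3 qE _; rewrite -{}qE in q3; split=> [P nsP | G P nsP].
  exact: dgz_flex.
exact: dgz_frobenius.
Qed.
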